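(* There does not exist $s\in S_1$ such that $$\frac{\mathrm{Tr}_{F/K}\bigl((\Pi_{G'}s)^{p-1}\bigr)}{\Delta_{A/R}}\in\Bbbk^\times .$$
   Context: Let $\Bbbk$ be a field of characteristic $p>0$ containing two elements $\alpha,\beta$ such that $\alpha\notin\mathbb F_p$ and $\beta\notin\mathbb F_p(\alpha)$. Let $S=\Bbbk[x_1,x_2,x_3,y]$, standard graded. Let $\tau_1,\tau_2,\tau_3,\sigma$ be the $\Bbbk$-algebra automorphisms of $S$ that fix $x_1$ and $x_3$ and satisfy $\tau_1: x_2\mapsto x_2+x_1,\ y\mapsto y+x_1$; $\tau_2: x_2\mapsto x_2+\alpha x_1,\ y\mapsto y+x_1$; $\tau_3: x_2\mapsto x_2,\ y\mapsto y+\beta x_1$; $\sigma: x_2\mapsto x_2,\ y\mapsto y+x_3$. Let $G=\langle\tau_1,\tau_2,\tau_3,\sigma\rangle$ and $G'=\langle\tau_1,\tau_2,\tau_3\rangle$ (a normal subgroup of the abelian group $G$), and write $R=S^G$, $A=S^{G'}$, $K=\mathrm{Frac}(R)$, $F=\mathrm{Frac}(A)$, and $\mathrm{Tr}_{F/K}$ for the field trace. For $s\in S$, $\Pi_{G'}s=\prod_{s'\in G's}s'$ is the product of the elements of the $G'$-orbit of $s$. The Dedekind different of $A/R$ is the ideal $\mathscr D_D(A/R)=\{x\in F\mid x\cdot C\subseteq A\}$ of $A$, where $C=\{z\in F\mid \mathrm{Tr}_{F/K}(zA)\subseteq R\}$. It is a homogeneous principal ideal of the UFD $A$; $\Delta_{A/R}$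 denotes a fixed homogeneous generator of it. *)

(* Defs.v *)
From HB Require Import structures.
From mathcomp Require Export all_boot all_algebra.
From mathcomp Require Export boolp classical_sets functions cardinality fsbigop.
From mathcomp Require Export mpoly.

Set Implicit Arguments.
Unset Strict Implicit.
Unset Printing Implicit Defensive.

Import GRing.Theory.

Local Open Scope classical_set_scope.
Local Open Scope ring_scope.

Section Subfields.
Variable L : fieldType.

(* Smallest subfield of L containing X. *)
Definition generated_subfield (X : set L) : set L :=
  [set x | forall P : {pred L},
     GRing.divring_closed P -> (forall a, X a -> a \in P) -> x \in P].

(* In positive characteristic the images of the naturals exhaust F_p. *)
Definition prime_subfield : set L := [set n%:R | n in [set: nat]].

Definition Fp_adjoin (a : L) : set L :=
  generated_subfield (prime_subfield `|` [set a]).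

End Subfields.

Section FieldTrace.
Variable L : fieldType.
Implicit Types K F : set L.

Definition is_basis K F (n : nat) (b : 'I_n -> L) : Prop :=
  (forall i, F (b i)) /\
  forall x, F x -> exists! c : {ffun 'I_n -> L},
    (forall i, K (c i)) /\ x = \sum_i c i * b i.

(* t is the trace of the K-linear endomorphism "multiplication by x" of F. *)
Definition is_field_trace K F (x t : L) : Prop :=
  exists (n : nat) (b : 'I_n -> L) (M : 'M[L]_n),
    [/\ is_basis K F b,
        forall i j, K (M i j),
        forall i, x * b i = \sum_j M i j * b j
      & t = \tr M].

(* Tr_{F/K}, for subfields K of F of L with F finite over K and x in F; such a
   trace exists and is unique, so the default value 0 is then irrelevant. *)
Definition field_trace K F (x : L) : L := xget 0 (is_field_trace K F x).

End FieldTrace.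

Section GroupsOfMaps.

Inductive generated_group (T : Type) (X : set (T -> T)) : (T -> T) -> Prop :=
  | generated_gen g : X g -> generated_group X g
  | generated_id : generated_group X id
  | generated_comp g h :
      generated_group X g -> generated_group X h -> generated_group X (g \o h)
  | generated_inv g h :
      generated_group X g -> cancel g h -> cancel h g -> generated_group X h.

Definition invariants (T : Type) (H : set (T -> T)) : set T :=
  [set f | forall g, H g -> g f = f].

Definition orbit_set (T : Type) (H : set (T -> T)) (s : T) : set T :=
  [set g s | g in H].

(* The product runs over the distinct elements of the orbit; it is only
   meaningful when the orbit is finite. *)
Definition orbit_prod (S : comNzRingType) (H : set (S -> S)) (s : S) : S :=
  \big[*%R/1]_(t \in orbit_set H s) t.

End GroupsOfMaps.

Section DedekindDifferent.
Variable S : idomainType.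
Implicit Types R A : set S.

Definition in_frac A : set {fraction S} := [set tofrac a | a in A].

(* Frac(A), identified with a subfield of Frac(S). *)
Definition frac_set A : set {fraction S} :=
  [set x | exists a b, [/\ A a, A b, b != 0 & x = tofrac a / tofrac b]].

(* {z in Frac(A) | Tr(zA) is contained in R} *)
Definition complementary_module R A : set {fraction S} :=
  [set z | frac_set A z /\ forall a, A a ->
     in_frac R (field_trace (frac_set R) (frac_set A) (z * tofrac a))].

Definition dedekind_different R A : set {fraction S} :=
  [set x | frac_set A x /\
     forall z, complementary_module R A z -> in_frac A (x * z)].

Definition is_generator A (I : set {fraction S}) (d : S) : Prop :=
  A d /\ I = [set tofrac (d * a) | a in A].

End DedekindDifferent.

Section Example.
Variable k : fieldType.

Definition x1 : {mpoly k[4]} := 'X_(@Ordinal 4 0 isT).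
Definition x2 : {mpoly k[4]} := 'X_(@Ordinal 4 1 isT).
Definition x3 : {mpoly k[4]} := 'X_(@Ordinal 4 2 isT).
Definition y : {mpoly k[4]} := 'X_(@Ordinal 4 3 isT).

(* The k-algebra endomorphism x1, x2, x3, y |-> f1, f2, f3, f4. *)
Definition subst4 (f1 f2 f3 f4 : {mpoly k[4]}) (f : {mpoly k[4]}) :
  {mpoly k[4]} := f \mPo [tuple f1; f2; f3; f4].

Variables alpha beta : k.

Definition tau1 := subst4 x1 (x2 + x1) x3 (y + x1).
Definition tau2 := subst4 x1 (x2 + alpha *: x1) x3 (y + x1).
Definition tau3 := subst4 x1 x2 x3 (y + beta *: x1).
Definition sigma := subst4 x1 x2 x3 (y + x3).

Definition G : set ({mpoly k[4]} -> {mpoly k[4]}) :=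
  generated_group [set g | [\/ g = tau1, g = tau2, g = tau3 | g = sigma]].

Definition G' : set ({mpoly k[4]} -> {mpoly k[4]}) :=
  generated_group [set g | [\/ g = tau1, g = tau2 | g = tau3]].

Definition ringR : set {mpoly k[4]} := invariants G.
Definition ringA : set {mpoly k[4]} := invariants G'.

Definition TrFK : {fraction {mpoly k[4]}} -> {fraction {mpoly k[4]}} :=
  field_trace (frac_set ringR) (frac_set ringA).

Definition homogeneous_different_generator (Delta : {mpoly k[4]}) : Prop :=
  (exists d : nat, Delta \is d.-homog) /\
  is_generator ringA (dedekind_different ringR ringA) Delta.

End Example.

(* Main.v *)
From HB Require Import structures.
Require Import Defs.
From mathcomp Require Import generic_quotient ring.

Set Implicit Arguments.
Unset Strict Implicit.
Unset Printing Implicit Defensive.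

Import GRing.Theory.

Local Open Scope classical_set_scope.
Local Open Scope ring_scope.

(** If [theta] in A satisfies [sigma theta = theta + B] with B in R nonzero,
    then F = K(theta) is an Artin-Schreier extension and Euler's formula shows
    that [f'(theta) = - B^(p-1)], f the minimal polynomial of [theta], lies in
    the different; so the generator Delta divides [B^(p-1)].  Taking for
    [theta] the orbit products of [y - x2] and of [y - x2/alpha], B becomes the
    product of the [x3 + w x1] with w in the F_p-span of [1 - alpha, beta],
    resp. of [1 - 1/alpha, beta]; these two planes meet in the line F_p beta.

    Suppose Delta is a scalar multiple of the trace of [N^(p-1)], N the orbit
    product of [s = a x1 + b x2 + c x3 + d y].  If d = 0 then [sigma N = N] and
    the trace vanishes.  Otherwise, setting [x1 := 1] and [x3 := w/d], where w is
    [b + d] or [b alpha + d], identifies all the [sigma^j N], so that Delta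
    vanishes there in characteristic p.  By the divisibility above both values
    w/d belong to F_p beta, which makes beta an element of F_p(alpha). *)

(** * The prime field as the fixed points of Frobenius *)

Section PrimeSubfield.
Variables (p : nat) (L : fieldType) (chp : p \in [pchar L]).

Lemma natr_Fermat n : (n%:R : L) != 0 -> (n%:R : L) ^+ p.-1 = 1.
Proof.
move=> n0; apply: (mulfI n0); rewrite -exprS prednK ?mulr1.
  exact: pFrobenius_aut_nat chp n.
exact/prime_gt0/pcharf_prime/chp.
Qed.

Lemma natr_pchar_inj : {in gtn p &, injective (fun i => i%:R : L)}.
Proof.
move=> i j; wlog le_ij: i j / (i <= j)%N => [hw|] ip jp.
  by case/orP: (leq_total i j) => h e; [|apply/esym]; apply: hw.
move=> /esym/eqP; rewrite -subr_eq0 -natrB // -(dvdn_pcharf chp).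
have [//|ltij] := eqVneq i j.
move=> /dvdn_leq; rewrite subn_gt0 ltn_neqAle ltij => /(_ le_ij).
by rewrite leqNgt (leq_ltn_trans (leq_subr _ _)).
Qed.

(** The images of 0, ..., p - 1 are already p distinct roots of X^p - X, so its degree leaves no
    room for another root. *)
Lemma pFrobenius_fixed (t : L) : t ^+ p = t -> prime_subfield t.
Proof.
move=> tp; have p2 := prime_gt1 (pcharf_prime chp).
pose rs := [seq i%:R : L | i <- iota 0 p].
have rsu : uniq rs.
  rewrite map_inj_in_uniq ?iota_uniq // => i j.
  by rewrite !mem_iota; apply: natr_pchar_inj.
suff /mapP [i _ ->] : t \in rs by exists i.
apply: contraT => tN.
have Xp0 : ('X^p - 'X : {poly L}) != 0.
  by rewrite -size_poly_gt0 size_polyDl ?size_polyN size_polyXn ?size_polyX.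
have /(max_poly_roots Xp0) : all (root ('X^p - 'X : {poly L})) (t :: rs).
  rewrite /= rootE !hornerE tp subrr eqxx; apply/allP => _ /mapP [i _ ->].
  by rewrite rootE !hornerE -(pFrobenius_autE chp) pFrobenius_aut_nat subrr.
rewrite cons_uniq tN rsu => /(_ isT).
rewrite size_polyDl ?size_polyN size_polyXn ?size_polyX //.
by rewrite /= size_map size_iota ltnn.
Qed.

End PrimeSubfield.

(** * Artin-Schreier extensions: Euler's formula, the power basis, and the trace as a sum of
    conjugates *)

Section ArtinSchreier.
Variables (p : nat) (L : fieldType) (s : {rmorphism L -> L}).
Hypothesis chp : p \in [pchar L].
Implicit Types K F : set L.

Definition subfield_set F :=
  [/\ F 1, forall x y, F x -> F y -> F (x - y)
         & forall x y, F x -> F y -> F (x / y)].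

Lemma subfield_set0 F : subfield_set F -> F 0.
Proof. by case=> F1 FB _; rewrite -(subrr 1); apply: FB. Qed.

Lemma subfield_setN F x : subfield_set F -> F x -> F (- x).
Proof.
move=> sF Fx; have [_ FB _] := sF.
by rewrite -sub0r; apply: FB => //; exact: subfield_set0.
Qed.

Lemma subfield_setD F x z : subfield_set F -> F x -> F z -> F (x + z).
Proof.
move=> sF Fx Fz; have [_ FB _] := sF; rewrite -(opprK z).
by apply: FB => //; exact: subfield_setN.
Qed.

Lemma subfield_setM F x z : subfield_set F -> F x -> F z -> F (x * z).
Proof.
move=> sF Fx Fz; have [F1 _ FV] := sF; rewrite -(invrK z).
by apply: (FV) => //; rewrite -div1r; apply: FV.
Qed.

Lemma subfield_setX F x n : subfield_set F -> F x -> F (x ^+ n).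
Proof.
move=> sF Fx; elim: n => [|n IH]; first by rewrite expr0; case: sF.
by rewrite exprS; apply: subfield_setM.
Qed.

Lemma subfield_setMn F x n : subfield_set F -> F x -> F (x *+ n).
Proof.
move=> sF Fx; elim: n => [|n IH]; first exact: subfield_set0.
by rewrite mulrS; apply: subfield_setD.
Qed.

Lemma subfield_set_sum F (I : Type) (r : seq I) (f : I -> L) :
  subfield_set F -> (forall i, F (f i)) -> F (\sum_(i <- r) f i).
Proof.
move=> sF Ff; apply: (big_ind F) => //; first exact: subfield_set0.
by move=> *; apply: subfield_setD.
Qed.

Definition sigma_trace (x : L) := \sum_(j < p) iter j s x.

Lemma iter_rmorphM j : {morph iter j s : x z / x * z}.
Proof. by move=> x z; elim: j => //= j ->; rewrite rmorphM. Qed.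

Lemma iter_rmorphX j n : {morph iter j s : x / x ^+ n}.
Proof. by move=> x; elim: j => //= j ->; rewrite rmorphXn. Qed.

Lemma iter_rmorph_sum j (I : Type) (r : seq I) (f : I -> L) :
  iter j s (\sum_(i <- r) f i) = \sum_(i <- r) iter j s (f i).
Proof. by elim: j => //= j ->; rewrite rmorph_sum. Qed.

Variables (theta B : L).
Hypotheses (sB : s B = B) (stheta : s theta = theta + B).

Lemma iter_theta j : iter j s theta = theta + B *+ j.
Proof.
elim: j => [|j IH] /=; first by rewrite addr0.
by rewrite IH rmorphD rmorphMn /= stheta sB mulrS addrA.
Qed.

(* This is Euler's formula [f'(theta) x = \sum_j (s^j x) (f/(T - s^j theta))(theta)]
   for the minimal polynomial f of theta, where f'(theta) = - B^(p-1) and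
   f/(T - t) = (T - t)^(p-1) - B^(p-1) for each root t of f. *)
Lemma artin_schreier_euler x :
  x * B ^+ p.-1 = B ^+ p.-1 * sigma_trace x
   - \sum_(i < p) ((-1) ^+ i * theta ^+ (p.-1 - i)) *+ 'C(p.-1, i)
                   * sigma_trace (x * theta ^+ i).
Proof.
have p_gt1 := prime_gt1 (pcharf_prime chp).
(* Binomial expansion of the power on the right, followed by an interchange of the two sums. *)
have -> : \sum_(i < p) ((-1) ^+ i * theta ^+ (p.-1 - i)) *+ 'C(p.-1, i)
                   * sigma_trace (x * theta ^+ i)
   = \sum_(j < p) iter j s x * (theta - iter j s theta) ^+ p.-1.
  under [RHS]eq_bigr => j _ do rewrite exprBn prednK ?(ltnW p_gt1) // mulr_sumr.
  rewrite exchange_big; apply: eq_bigr => i _; rewrite mulr_sumr.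
  apply: eq_bigr => j _; rewrite iter_rmorphM iter_rmorphX.
  by rewrite !(mulrnAl, mulrnAr); congr (_ *+ _); rewrite !mulrA; congr (_ * _); rewrite mulrC mulrA.
rewrite /sigma_trace mulr_sumr -sumrB.
have p0 : (0 < p)%N := ltnW p_gt1.
(* The power vanishes for j = 0, since p - 1 > 0, and only that conjugate survives. For j > 0 the
   power is (- j B)^(p-1) = B^(p-1) and the two terms cancel. *)
rewrite (bigD1 (Ordinal p0)) //= subrr expr0n gtn_eqF -?subn1 ?subn_gt0 //.
rewrite subn1 mulr0 subr0 big1 ?addr0 => [|j j0]; first by rewrite mulrC.
rewrite iter_theta opprD addNKr exprNn -[B *+ j]mulr_natl exprMn.
rewrite (natr_Fermat chp) ?mul1r; last first.
  rewrite -(dvdn_pcharf chp) gtnNdvd //.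
  by rewrite lt0n; apply: contra j0 => /eqP e; apply/eqP/val_inj.
(* Reading this off (-1)^p = -1 avoids separating p = 2 from odd p. *)
have -> : (-1) ^+ p.-1 = 1 :> L.
  have /eqP := pFrobenius_autN chp 1; rewrite !pFrobenius_autE expr1n.
  by rewrite -{1}[p]prednK // exprS mulN1r eqr_opp => /eqP.
by rewrite mul1r mulrC subrr.
Qed.

Variables (K F : set L).
Hypotheses (sF : subfield_set F) (KE : K = [set x | F x /\ s x = x]).
Hypotheses (FS : forall x, F x -> F (s x)) (s_p : forall x, F x -> iter p s x = x).
Hypotheses (Ftheta : F theta) (FB : F B) (B0 : B != 0).

Lemma subfield_fixed : subfield_set K.
Proof.
case: sF => F1 FD FV; rewrite KE; split => /=; first by rewrite rmorph1.
- by move=> x z [Fx sx] [Fz sz]; rewrite rmorphB /= sx sz; split => //; apply: FD.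
- by move=> x z [Fx sx] [Fz sz]; rewrite fmorph_div /= sx sz; split => //; apply: FV.
Qed.

(** Applying [s] permutes the conjugates cyclically, because [s] iterated p times is the identity on
    F. *)
Lemma sigma_trace_fixed x : F x -> K (sigma_trace x).
Proof.
move=> Fx; have Fi j : F (iter j s x) by elim: j => //= j; exact: FS.
rewrite KE; split; first by apply: subfield_set_sum => // i; exact: Fi.
have p0 := prime_gt0 (pcharf_prime chp).
rewrite /sigma_trace rmorph_sum -(prednK p0) big_ord_recr [RHS]big_ord_recl /=.
by rewrite -iterS prednK // s_p // addrC.
Qed.

(** Euler's formula divided by B^(p-1): its coefficients are traces, hence lie in K. *)
Lemma power_expansion x : F x ->
  exists c : 'I_p -> L, (forall i, K (c i)) /\ x = \sum_i c i * theta ^+ i.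
Proof.
move=> Fx; have sK := subfield_fixed; have p0 := prime_gt0 (pcharf_prime chp).
have KB : K (B ^+ p.-1) by apply: subfield_setX => //; rewrite KE.
have Km1 : K (-1) by apply: subfield_setN => //; case: sK.
(* The coefficient of theta^i comes from the summand of index p - 1 - i; the isolated trace of x
   contributes to theta^0 only. *)
pose c (i : 'I_p) := (if i == 0 :> nat then B ^+ p.-1 * sigma_trace x else 0)
   - ((-1) ^+ (p.-1 - i) *+ 'C(p.-1, p.-1 - i)) * sigma_trace (x * theta ^+ (p.-1 - i)).
exists (fun i => c i / B ^+ p.-1); split.
  move=> i; case: (sK) => _ KD KV; apply: KV => //; apply: KD.
    case: ifP => _; last exact: subfield_set0.
    by apply: subfield_setM => //; exact: sigma_trace_fixed.
  apply: subfield_setM => //.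
    by apply: subfield_setMn => //; exact: subfield_setX.
  by apply: sigma_trace_fixed; apply: subfield_setM => //; exact: subfield_setX.
have B1 : B ^+ p.-1 != 0 by rewrite expf_neq0.
apply: (mulIf B1); rewrite mulr_suml.
under eq_bigr => i _ do rewrite mulrAC divfK // /c mulrBl.
rewrite sumrB artin_schreier_euler; congr (_ - _).
  rewrite (bigD1 (Ordinal p0)) //= expr0 mulr1 big1 ?addr0 // => i i0.
  by rewrite ifN ?mul0r.
rewrite (reindex_inj rev_ord_inj); apply: eq_bigr => i _ /=.
have -> : (p - i.+1 = p.-1 - i)%N by rewrite -subn1 -subnDA add1n.
rewrite subKn; last by rewrite -ltnS prednK.
by rewrite !mulrnAl [in RHS]mulrAC.
Qed.

(** Applying powers of [s] to a relation shows that a polynomial of degree less than p vanishes at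
    the p distinct points theta + j B. *)
Lemma power_free (c : 'I_p -> L) :
  (forall i, K (c i)) -> \sum_i c i * theta ^+ i = 0 -> forall i, c i = 0.
Proof.
move=> Kc c0; have p0 := prime_gt0 (pcharf_prime chp).
(* [insub] turns a natural number into an index; its default 0 is never reached below p. *)
pose P := \poly_(i < p) (if insub i is Some j then c j else 0).
have PE t : P.[t] = \sum_i c i * t ^+ i.
  by rewrite horner_poly; apply: eq_bigr => i _; rewrite valK.
suff P0 : P = 0.
  by move=> i; have := congr1 (fun q : {poly L} => q`_i) P0; rewrite coef_poly ltn_ord valK coef0.
apply: (@roots_geq_poly_eq0 _ _ [seq theta + B *+ i | i <- iota 0 p]).
- apply/allP => _ /mapP [j _ ->]; rewrite rootE PE -iter_theta; apply/eqP.
  transitivity (iter j s 0); last by elim: (j) => //= m ->; rewrite rmorph0.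
  rewrite -(congr1 (iter j s) c0) iter_rmorph_sum; apply: eq_bigr => i _.
  rewrite iter_rmorphM iter_rmorphX; congr (_ * _).
  have : K (c i) by []; rewrite KE => -[_ sc].
  by elim: (j) => //= m IH; rewrite -IH sc.
- rewrite map_inj_in_uniq ?iota_uniq // => i j; rewrite !mem_iota => ip jp.
  move=> /addrI; rewrite -[_ *+ i]mulr_natl -[_ *+ j]mulr_natl => /(mulIf B0).
  exact: (natr_pchar_inj chp).
- by rewrite size_map size_iota size_poly.
Qed.

Lemma power_basis : is_basis K F (fun i : 'I_p => theta ^+ i).
Proof.
split=> [i|x Fx]; first exact: subfield_setX.
have [c [Kc xE]] := power_expansion Fx.
exists [ffun i => c i]; split=> [|d [Kd xE']].
  by split=> [i|]; [rewrite ffunE|rewrite xE; apply: eq_bigr => i _; rewrite ffunE].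
apply/ffunP => i; rewrite ffunE; apply/eqP; rewrite -subr_eq0; apply/eqP.
apply: (power_free (c := fun i => c i - d i)) => [j|].
  by have [_ KB _] := subfield_fixed; apply: KB.
by under eq_bigr => j _ do rewrite mulrBl; rewrite sumrB -xE -xE' subrr.
Qed.

Lemma basis_matrix n (b : 'I_n -> L) m (f : 'I_m -> L) : is_basis K F b ->
  (forall i, F (f i)) ->
  exists T : 'M[L]_(m, n), (forall i j, K (T i j)) /\ forall i, f i = \sum_j T i j * b j.
Proof.
move=> [_ bF] Ff.
have /choice [c cP] i : exists c : {ffun 'I_n -> L},
    (forall j, K (c j)) /\ f i = \sum_j c j * b j.
  by have [c [? _]] := bF _ (Ff i); exists c.
exists (\matrix_(i, j) c i j); split=> [i j|i]; first by rewrite mxE; case: (cP i).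
by case: (cP i) => _ ->; apply: eq_bigr => j _; rewrite mxE.
Qed.

(** Coordinates are unique, and the i-th unit vector also represents [b i]. *)
Lemma basis_matrix_eq1 n (b : 'I_n -> L) (T : 'M[L]_n) : is_basis K F b ->
  (forall i j, K (T i j)) -> (forall i, b i = \sum_j T i j * b j) -> T = 1%:M.
Proof.
move=> [Fb bF] KT bE; apply/matrixP => i j; have sK := subfield_fixed.
have [c [_ cu]] := bF _ (Fb i).
have cT : c = [ffun j => T i j].
  apply: cu; split=> [l|]; first by rewrite ffunE.
  by rewrite {1}bE; apply: eq_bigr => l _; rewrite ffunE.
have : c = [ffun j => (i == j)%:R].
  apply: cu; split=> [l|].
    by rewrite ffunE; case: eqP => _; [case: sK | exact: subfield_set0].
  rewrite (bigD1 i) //= ffunE eqxx mul1r big1 ?addr0 // => l il.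
  by rewrite ffunE eq_sym (negPf il) mul0r.
by rewrite cT => /ffunP => /(_ j); rewrite !ffunE mxE.
Qed.

(** The matrix of conjugates of a basis diagonalises multiplication by x, with eigenvalues the
    conjugates of x: entries in K are fixed by [s], so [s] may be applied to the defining relations
    of M. *)
Lemma field_trace_sigma x : F x -> field_trace K F x = sigma_trace x.
Proof.
move=> Fx; have sK := subfield_fixed; have bth := power_basis.
have FM u v : F u -> F v -> F (u * v) by exact: subfield_setM.
pose conj n (b : 'I_n -> L) : 'M_(n, p) := \matrix_(i, l) iter l s (b i).
have conjM m n (b : 'I_n -> L) (f : 'I_m -> L) (T : 'M[L]_(m, n)) :
    (forall i j, K (T i j)) -> (forall i, f i = \sum_j T i j * b j) ->
    conj _ f = T *m conj _ b.
  move=> KT fE; apply/matrixP => i l; rewrite !mxE fE iter_rmorph_sum.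
  apply: eq_bigr => j _; rewrite iter_rmorphM mxE; congr (_ * _).
  have : K (T i j) by []; rewrite KE => -[_ sc].
  by elim: (val l) => //= k ->; rewrite sc.
(* For the power basis this is a Vandermonde matrix, invertible because the conjugates theta + j B
   are distinct. *)
set V := conj _ (fun i : 'I_p => theta ^+ i).
have Vu : V \in unitmx.
  have -> : V = Vandermonde p (\row_(l < p) iter l s theta).
    by apply/matrixP => i l; rewrite !mxE iter_rmorphX.
  rewrite unitmxE det_Vandermonde unitfE; apply/prodf_neq0 => i _.
  apply/prodf_neq0 => j ij; rewrite !mxE !iter_theta subr_eq0.
  apply: contraTneq ij => /addrI.
  rewrite -[_ *+ j]mulr_natl -[_ *+ i]mulr_natl => /(mulIf B0).
  by move/(natr_pchar_inj chp); rewrite !inE !ltn_ord => /(_ isT isT) ->; rewrite ltnn.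
rewrite /field_trace; case: xgetP => [t _ [n [b [M [bb KM xb ->]]]] | no].
  have [T [KT bE]] := basis_matrix bth (proj1 bb).
  have [U [KU tE]] := basis_matrix bb (proj1 bth).
  have KMul a1 a2 a3 (P : 'M[L]_(a1, a2)) (Q : 'M[L]_(a2, a3)) :
    (forall i j, K (P i j)) -> (forall i j, K (Q i j)) ->
    forall i j, K ((P *m Q) i j).
    move=> KP KQ i j; rewrite mxE; apply: subfield_set_sum => // l.
    exact: subfield_setM.
  have comp a1 a2 a3 (P : 'M[L]_(a1, a2)) (Q : 'M[L]_(a2, a3)) f g h :
    (forall i, f i = \sum_j P i j * g j) -> (forall i, g i = \sum_j Q i j * h j) ->
    forall i, f i = \sum_j (P *m Q) i j * h j.
    move=> fE gE i; rewrite fE; under eq_bigr => j _ do rewrite gE mulr_sumr.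
    rewrite exchange_big; apply: eq_bigr => l _; rewrite mxE mulr_suml.
    by apply: eq_bigr => j _; rewrite mulrA.
  (* The size n of the given basis is not known to be p. The changes of basis stay rectangular,
     inverse to each other on both sides, and the trace is still cyclic on such products. *)
  have TU : T *m U = 1%:M.
    by apply: (basis_matrix_eq1 bb); [exact: KMul|exact: (comp _ _ _ _ _ _ _ _ bE tE)].
  have UT : U *m T = 1%:M.
    by apply: (basis_matrix_eq1 bth); [exact: KMul|exact: (comp _ _ _ _ _ _ _ _ tE bE)].
  pose D := diag_mx (\row_(l < p) iter l s x).
  have QE : conj _ b = T *m V by exact: conjM.
  have MQ : M *m conj _ b = conj _ b *m D.
    rewrite -(conjM _ _ _ (fun i => x * b i)) //.
    by apply/matrixP => i l; rewrite mul_mx_diag !mxE iter_rmorphM mulrC.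
  have -> : M = T *m V *m D *m (invmx V *m U).
    by rewrite -QE -MQ -mulmxA QE -mulmxA (mulmxA V) mulmxV // mul1mx TU mulmx1.
  rewrite -!mulmxA mxtrace_mulC -!mulmxA UT mulmx1 mxtrace_mulC -mulmxA mulVmx //.
  by rewrite mulmx1 mxtrace_diag; apply: eq_bigr => i _; rewrite mxE.
(* The default value of [xget] is excluded: the power basis provides a trace. *)
have [M [KM xE]] := basis_matrix bth (fun i => FM _ _ Fx (proj1 bth i)).
by case: (no (\tr M)); exists p, (fun i : 'I_p => theta ^+ i), M.
Qed.

End ArtinSchreier.

(** * Extension of an injective endomorphism of a domain to its fraction field *)

Section FractionMap.
Variable S : idomainType.

Lemma fraction_numden (x : {fraction S}) :
  x = tofrac \n_(repr x) / tofrac \d_(repr x).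
Proof.
have d0 : tofrac \d_(repr x) != 0 :> {fraction S}.
  by rewrite tofrac_eq0 denom_ratioP.
apply: (mulIf d0); rewrite divfK // -{1}[x]reprK; apply/eqP.
rewrite -[_ * _]/(FracField.mul _ _) !piE FracField.equivfE /FracField.mulf.
by rewrite !numden_Ratio ?mulf_neq0 ?denom_ratioP ?oner_neq0 // !mulr1 mulrC.
Qed.

Variables (g : {rmorphism S -> S}) (g_inj : injective g).

(** The injectivity proof is an argument so that the morphism instances below can attach to the
    map. *)
Definition fraction_map of injective g := fun x : {fraction S} =>
  tofrac (g \n_(repr x)) / tofrac (g \d_(repr x)) : {fraction S}.

Local Notation gF := (fraction_map g_inj).

Lemma fraction_map_frac a b : b != 0 ->
  gF (tofrac a / tofrac b) = tofrac (g a) / tofrac (g b).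
Proof.
have g0 c : (g c == 0) = (c == 0) by rewrite -{1}(rmorph0 g) (inj_eq g_inj).
move=> b0; rewrite /fraction_map; set r := repr _.
have := fraction_numden (tofrac a / tofrac b); rewrite -/r => /eqP.
have r0 : \d_r != 0 by exact: denom_ratioP.
rewrite eqr_div ?tofrac_eq0 // -!tofracM tofrac_eq => /eqP e.
apply/eqP; rewrite eqr_div ?tofrac_eq0 ?g0 // -!tofracM tofrac_eq -!rmorphM.
by rewrite e.
Qed.

Lemma fraction_map_tofrac a : gF (tofrac a) = tofrac (g a).
Proof.
rewrite -[tofrac a]divr1 -tofrac1 fraction_map_frac ?oner_neq0 //.
by rewrite rmorph1 tofrac1 divr1.
Qed.

Lemma fraction_map_is_zmod_morphism : zmod_morphism gF.
Proof.
move=> x z; rewrite (fraction_numden x) (fraction_numden z).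
move: \n_(repr x) \d_(repr x) (denom_ratioP (repr x)) => a b b0.
move: \n_(repr z) \d_(repr z) (denom_ratioP (repr z)) => c d d0.
have gn0 e : e != 0 -> g e != 0 by rewrite -(inj_eq g_inj) rmorph0.
rewrite !fraction_map_frac // -!mulNr -!tofracN !addf_div ?tofrac_eq0 ?gn0 //.
rewrite -!tofracM -!tofracD fraction_map_frac ?mulf_neq0 //.
by rewrite !rmorphD !rmorphM !rmorphN.
Qed.

Lemma fraction_map_is_monoid_morphism : monoid_morphism gF.
Proof.
split; first by rewrite -tofrac1 fraction_map_tofrac rmorph1.
move=> x z; rewrite (fraction_numden x) (fraction_numden z).
move: \n_(repr x) \d_(repr x) (denom_ratioP (repr x)) => a b b0.
move: \n_(repr z) \d_(repr z) (denom_ratioP (repr z)) => c d d0.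
rewrite mulf_div -!tofracM !fraction_map_frac ?mulf_neq0 // mulf_div.
by rewrite -!tofracM !rmorphM.
Qed.

HB.instance Definition _ := GRing.isZmodMorphism.Build _ _ gF
  fraction_map_is_zmod_morphism.
HB.instance Definition _ := GRing.isMonoidMorphism.Build _ _ gF
  fraction_map_is_monoid_morphism.

End FractionMap.

(** * Fraction fields of invariants, traces, and an element of the different *)

Section CyclicInvariants.
Variables (p : nat) (S : idomainType) (chp : p \in [pchar S]).
Variables (g : {rmorphism S -> S}) (g_inj : injective g) (R A : set S).

Definition subring_set (X : set S) :=
  [/\ X 1, forall a b, X a -> X b -> X (a - b)
         & forall a b, X a -> X b -> X (a * b)].

Hypotheses (sA : subring_set A) (RE : R = [set a | A a /\ g a = a]).
Hypotheses (gA : forall a, A a -> A (g a)).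
Hypotheses (gp : forall a, A a -> iter p g a = a).

Local Notation gF := (fraction_map g_inj).

Lemma subring_set0 : A 0.
Proof. by case: sA => A1 AB _; rewrite -(subrr 1); apply: AB. Qed.

Lemma subring_setN a : A a -> A (- a).
Proof.
have [_ AB _] := sA; move=> Aa; rewrite -sub0r; apply: AB => //.
exact: subring_set0.
Qed.

Lemma subring_setD a b : A a -> A b -> A (a + b).
Proof.
have [_ AB _] := sA; move=> Aa Ab; rewrite -(opprK b); apply: AB => //.
exact: subring_setN.
Qed.

Lemma subring_setX a n : A a -> A (a ^+ n).
Proof.
have [A1 _ AM] := sA; move=> Aa; elim: n => [|n IH]; first by rewrite expr0.
by rewrite exprS; apply: AM.
Qed.

Lemma subring_set_prod n (f : 'I_n -> S) :
  (forall i, A (f i)) -> A (\prod_i f i).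
Proof. by have [A1 _ AM] := sA => Af; apply: (big_ind A). Qed.

Lemma frac_set_subfield : subfield_set (frac_set A).
Proof.
have [A1 AB AM] := sA; split.
- by exists 1, 1; split; rewrite ?oner_neq0 ?tofrac1 ?divr1.
- move=> _ _ [a [b [Aa Ab b0 ->]]] [c [d [Ac Ad d0 ->]]].
  exists (a * d - c * b), (b * d); split; rewrite ?mulf_neq0 //.
  + by apply: (AB); apply: (AM).
  + exact: AM.
  + rewrite -mulNr -tofracN addf_div ?tofrac_eq0 // -!tofracM -tofracD.
    by rewrite mulNr.
- move=> _ _ [a [b [Aa Ab b0 ->]]] [c [d [Ac Ad d0 ->]]].
  have [->|c0] := eqVneq c 0.
    exists 0, 1; split; rewrite ?oner_neq0 //; first exact: subring_set0.
    by rewrite tofrac0 mul0r invr0 mulr0 mul0r.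
  exists (a * d), (b * c); split; rewrite ?mulf_neq0 //; try exact: AM.
  by rewrite invf_div mulf_div -!tofracM.
Qed.

Lemma frac_set_tofrac a : A a -> frac_set A (tofrac a).
Proof.
have [A1 _ _] := sA; exists a, 1; split; rewrite ?oner_neq0 //.
by rewrite tofrac1 divr1.
Qed.

Lemma fraction_map_stable x : frac_set A x -> frac_set A (gF x).
Proof.
move=> [a [b [Aa Ab b0 ->]]]; exists (g a), (g b); split; try exact: gA.
  by rewrite -(rmorph0 g) (inj_eq g_inj).
exact: fraction_map_frac.
Qed.

Lemma iter_fraction_map j a b : b != 0 ->
  iter j gF (tofrac a / tofrac b) = tofrac (iter j g a) / tofrac (iter j g b).
Proof.
move=> b0; elim: j => //= j ->; rewrite fraction_map_frac //.
by elim: j => //= j; rewrite -[X in _ -> _ != X](rmorph0 g) (inj_eq g_inj).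
Qed.

(* Multiplying numerator and denominator of a fixed fraction by the conjugates
   of the denominator makes the denominator, hence the numerator, fixed. *)
Lemma frac_set_fixed :
  frac_set R = [set x | frac_set A x /\ gF x = x].
Proof.
have [A1 AB AM] := sA; have p0 := prime_gt0 (pcharf_prime chp).
apply/seteqP; split=> [x [a [b [+ + b0 ->]]] | x [[a [b [Aa Ab b0 xE]]] gx]].
  rewrite RE => -[Aa ga] [Ab gb]; split; first by exists a, b.
  by rewrite fraction_map_frac // ga gb.
have Ai j : A (iter j g b) by elim: j => //= j; exact: gA.
pose c := \prod_(j < p.-1) iter j.+1 g b.
have bc : b * c = \prod_(j < p) iter j g b.
  by rewrite -[in RHS](prednK p0) big_ord_recl.
have Ac : A c by apply: subring_set_prod => j; exact: Ai.
have gbc : g (b * c) = b * c.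
  rewrite {1}bc rmorph_prod -[in LHS](prednK p0) big_ord_recr /=.
  by rewrite -iterS prednK // gp // mulrC.
have bc0 : b * c != 0.
  rewrite bc; apply/prodf_neq0 => j _; elim: (val j) => //= m.
  by rewrite -[X in _ -> _ != X](rmorph0 g) (inj_eq g_inj).
have c0 : c != 0 by apply: contraNneq bc0 => ->; rewrite mulr0.
have xE' : x = tofrac (a * c) / tofrac (b * c).
  by rewrite xE !tofracM -mulf_div divff ?mulr1 ?tofrac_eq0.
exists (a * c), (b * c); split=> //; rewrite RE; split => //; try exact: AM.
have : gF x * tofrac (b * c) = x * tofrac (b * c) by rewrite gx.
rewrite xE' fraction_map_frac // gbc !divfK ?tofrac_eq0 //.
by move/eqP; rewrite tofrac_eq => /eqP.
Qed.

Variables (theta B : S).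
Hypotheses (Atheta : A theta) (AB : A B) (gB : g B = B).
Hypotheses (gtheta : g theta = theta + B) (B0 : B != 0).

Let chpF : p \in [pchar {fraction S}].
Proof.
move: chp; rewrite !inE => /andP [-> /eqP e].
by rewrite -tofrac1 -tofracMn e tofrac0 eqxx.
Qed.

Lemma field_trace_frac x : frac_set A x ->
  field_trace (frac_set R) (frac_set A) x = \sum_(j < p) iter j gF x.
Proof.
move=> Ax; apply: (@field_trace_sigma p _ gF chpF (tofrac theta) (tofrac B)).
- by rewrite /= fraction_map_tofrac gB.
- by rewrite /= fraction_map_tofrac gtheta tofracD.
- exact: frac_set_subfield.
- exact: frac_set_fixed.
- exact: fraction_map_stable.
- move=> _ [a [b [Aa Ab b0 ->]]]; rewrite iter_fraction_map //.
  by rewrite !gp.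
- exact: frac_set_tofrac.
- exact: frac_set_tofrac.
- by rewrite tofrac_eq0.
- by [].
Qed.

Lemma field_trace_tofrac a : A a ->
  field_trace (frac_set R) (frac_set A) (tofrac a)
    = tofrac (\sum_(j < p) iter j g a).
Proof.
move=> Aa; rewrite field_trace_frac; last exact: frac_set_tofrac.
rewrite rmorph_sum; apply: eq_bigr => j _.
by elim: (val j) => //= m ->; rewrite fraction_map_tofrac.
Qed.

Lemma in_fracD (x z : {fraction S}) :
  in_frac A x -> in_frac A z -> in_frac A (x + z).
Proof.
move=> [a Aa <-] [b Ab <-].
by exists (a + b); [exact: subring_setD|rewrite tofracD].
Qed.

Lemma in_fracM (x z : {fraction S}) :
  in_frac A x -> in_frac A z -> in_frac A (x * z).
Proof.
have [_ _ AM] := sA.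
by move=> [a Aa <-] [b Ab <-]; exists (a * b); [exact: AM|rewrite tofracM].
Qed.

(** In Euler's formula for z in the complementary module, every trace of z theta^i lies in R, so z
    B^(p-1) is a combination of elements of A. *)
Lemma different_artin_schreier : dedekind_different R A (tofrac (B ^+ p.-1)).
Proof.
have AX n c : A c -> in_frac A (tofrac c ^+ n).
  by move=> Ac; exists (c ^+ n); [exact: subring_setX|rewrite tofracXn].
have [A1 _ AM] := sA.
have Am1 n : in_frac A ((-1) ^+ n).
  by rewrite -tofrac1 -tofracN; apply: AX; apply: subring_setN.
split; first by apply: frac_set_tofrac; apply: subring_setX.
move=> z [Az trz]; rewrite tofracXn mulrC.
have inA c : A c -> in_frac A (sigma_trace p gF (z * tofrac c)).
  move=> Ac; have := trz c Ac; rewrite field_trace_frac; last first.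
    exact: (subfield_setM frac_set_subfield Az (frac_set_tofrac Ac)).
  by case=> r; rewrite RE => -[Ar _] e; exists r.
rewrite (@artin_schreier_euler p _ gF chpF (tofrac theta) (tofrac B)); last first.
- by rewrite /= fraction_map_tofrac gtheta tofracD.
- by rewrite /= fraction_map_tofrac gB.
apply: in_fracD.
  by apply: in_fracM; [exact: AX | rewrite -[z]mulr1 -tofrac1; exact: inA].
rewrite -mulN1r; apply: in_fracM; first by rewrite -[-1]expr1; exact: Am1.
apply: (big_ind (in_frac A)) => [||i _].
- by exists 0; [exact: subring_set0|rewrite tofrac0].
- exact: in_fracD.
- rewrite -mulr_natl; apply: in_fracM.
    apply: in_fracM; last by apply: in_fracM; [exact: Am1|exact: AX].
    (* Binomial coefficients are sums of ones, and [Am1 0] provides 1. *)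
    elim: 'C(_, _) => [|n IH].
      by exists 0; [exact: subring_set0|rewrite tofrac0].
    by rewrite -natr1; apply: in_fracD => //; exact: (Am1 0).
  by rewrite -tofracXn; apply: inA; exact: subring_setX.
Qed.

End CyclicInvariants.

(** * Additive polynomials vanishing on a line or a plane over F_p *)

Section AdditivePolynomial.
Variables (p : nat) (S : comNzRingType) (chp : p \in [pchar S]).

(* The product of the [t - a v] for a in F_p. *)
Definition line_poly (v t : S) := t ^+ p - v ^+ p.-1 * t.

Lemma line_polyD v : {morph line_poly v : t z / t + z}.
Proof.
move=> t z; rewrite /line_poly.
have -> : (t + z) ^+ p = t ^+ p + z ^+ p by exact: (rmorphD (pFrobenius_aut chp)).
by rewrite mulrDr opprD addrACA.
Qed.

Lemma line_polyv v : line_poly v v = 0.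
Proof.
by rewrite /line_poly -exprSr prednK ?subrr // (prime_gt0 (pcharf_prime chp)).
Qed.

Lemma line_poly0 v : line_poly v 0 = 0.
Proof.
by rewrite /line_poly mulr0 subr0 expr0n gtn_eqF // (prime_gt0 (pcharf_prime chp)).
Qed.

(* The product of the [t - z], for z in the F_p-span of v and w, when v and w
   are linearly independent over F_p. *)
Definition plane_poly (v w t : S) := line_poly (line_poly v w) (line_poly v t).

Lemma plane_polyD v w : {morph plane_poly v w : t z / t + z}.
Proof. by move=> t z; rewrite /plane_poly !line_polyD. Qed.

Lemma plane_poly_l v w : plane_poly v w v = 0.
Proof. by rewrite /plane_poly line_polyv line_poly0. Qed.

Lemma plane_poly_r v w : plane_poly v w w = 0.
Proof. by rewrite /plane_poly line_polyv. Qed.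

Lemma plane_poly0 v w : plane_poly v w 0 = 0.
Proof. by rewrite /plane_poly !line_poly0. Qed.

End AdditivePolynomial.

Lemma rmorph_plane_poly p (S U : comNzRingType) (f : {rmorphism S -> U}) v w t :
  f (plane_poly p v w t) = plane_poly p (f v) (f w) (f t).
Proof. by rewrite /plane_poly /line_poly !(rmorphB, rmorphM, rmorphXn). Qed.

(** * Their roots in a field, and the independence of alpha and beta *)

Section AdditivePolynomialRoots.
Variables (p : nat) (k : fieldType) (chp : p \in [pchar k]).

Lemma prime_subfieldP (t : k) : prime_subfield t <-> t ^+ p = t.
Proof.
split=> [[n _ <-]|]; last exact: pFrobenius_fixed.
exact: (pFrobenius_aut_nat chp).
Qed.

(** For v nonzero, t / v is fixed by Frobenius; for v = 0 the equation reads t^p = 0. *)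
Lemma line_poly_root (v t : k) : line_poly p v t = 0 ->
  exists2 a, prime_subfield a & t = a * v.
Proof.
have p0 := prime_gt0 (pcharf_prime chp).
move=> /eqP; rewrite subr_eq0 => /eqP tp.
have [v0|v0] := eqVneq v 0.
  exists 0; first by exists 0%N.
  apply/eqP; have : t ^+ p == 0.
    rewrite tp v0 expr0n gtn_eqF ?mul0r // -subn1 subn_gt0.
    exact/prime_gt1/pcharf_prime/chp.
  by rewrite mul0r expf_eq0 p0.
exists (t / v); last by rewrite divfK.
apply/prime_subfieldP; rewrite expr_div_n tp -[X in _ / _ ^+ X](prednK p0) exprS.
by rewrite [v * _]mulrC -mulf_div divff ?mul1r ?expf_neq0.
Qed.

(** The outer line polynomial yields b in F_p, and by F_p-linearity t - b w is then a root of the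
    inner one. *)
Lemma plane_poly_root (v w t : k) : plane_poly p v w t = 0 ->
  exists a b, [/\ prime_subfield a, prime_subfield b & t = a * v + b * w].
Proof.
move=> /line_poly_root [b bp tE].
have : line_poly p v (t - b * w) = 0.
  have -> : line_poly p v (t - b * w) = line_poly p v t - b * line_poly p v w.
    rewrite line_polyD // tE; congr (_ + _).
    rewrite /line_poly exprNn exprMn (prime_subfieldP b).1 //.
    have -> : (-1) ^+ p = -1 :> k.
      by have := pFrobenius_autN chp 1; rewrite !pFrobenius_autE expr1n.
    by ring.
  by rewrite tE subrr.
move=> /line_poly_root [a ap tE']; exists a, b; split => //.
by rewrite -tE' subrK.
Qed.

Lemma prime_subfield_set : subfield_set (@prime_subfield k).
Proof.
split; first by exists 1%N.
- move=> x z /prime_subfieldP xp /prime_subfieldP zp; apply/prime_subfieldP.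
  by rewrite -[LHS]/(pFrobenius_aut chp (x - z)) rmorphB /= !pFrobenius_autE xp zp.
- move=> x z /prime_subfieldP xp /prime_subfieldP zp; apply/prime_subfieldP.
  by rewrite expr_div_n xp zp.
Qed.

Lemma generated_subfield_set (X : set k) : subfield_set (generated_subfield X).
Proof.
split=> [P cP _|x z Xx Xz P cP XP|x z Xx Xz P cP XP].
- by case: cP.
- by case: (cP) => _ PB _; apply: PB; [exact: Xx|exact: Xz].
- by case: (cP) => _ _ PV; apply: PV; [exact: Xx|exact: Xz].
Qed.

Lemma sub_generated_subfield (X : set k) : X `<=` generated_subfield X.
Proof. by move=> x Xx P _; apply. Qed.

Variables (alpha beta : k).
Hypotheses (halpha : ~ prime_subfield alpha) (hbeta : ~ Fp_adjoin alpha beta).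

Lemma alpha_free a b : prime_subfield a -> prime_subfield b ->
  a * alpha + b = 0 -> a = 0 /\ b = 0.
Proof.
move=> ap bp e; have [a0|a0] := eqVneq a 0.
  by split=> //; rewrite a0 mul0r add0r in e.
case: halpha; have -> : alpha = - b / a.
  by apply: (mulfI a0); rewrite mulrCA mulfV // mulr1; apply/eqP;
     rewrite -addr_eq0 e.
have sP := prime_subfield_set; have [_ _ PV] := sP.
by apply: PV => //; exact: subfield_setN.
Qed.

Lemma beta_free a b : Fp_adjoin alpha a -> Fp_adjoin alpha b ->
  a * beta + b = 0 -> a = 0 /\ b = 0.
Proof.
move=> ap bp e; have [a0|a0] := eqVneq a 0.
  by split=> //; rewrite a0 mul0r add0r in e.
case: hbeta; have -> : beta = - b / a.
  by apply: (mulfI a0); rewrite mulrCA mulfV // mulr1; apply/eqP;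
     rewrite -addr_eq0 e.
have sP : subfield_set (Fp_adjoin alpha) by exact: generated_subfield_set.
have [_ _ PV] := sP.
by apply: PV => //; exact: (subfield_setN sP).
Qed.

Lemma prime_Fp_adjoin : @prime_subfield k `<=` Fp_adjoin alpha.
Proof. by move=> x xp; apply: sub_generated_subfield; left. Qed.

Lemma Fp_adjoin_alpha : Fp_adjoin alpha alpha.
Proof. by apply: sub_generated_subfield; right. Qed.

Lemma alpha_neq0 : alpha != 0.
Proof. by apply/eqP => a0; case: halpha; rewrite a0; exists 0%N. Qed.

(** Comparing the two expressions of t over F_p(alpha) gives m (1 - alpha) = m' (1 - 1/alpha).
    Multiplied by alpha and divided by 1 - alpha this is m alpha + m' = 0, whence m = 0. *)
Lemma plane_polys_common_root t :
  plane_poly p (1 - alpha) beta t = 0 ->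
  plane_poly p (1 - alpha^-1) beta t = 0 ->
  exists2 n, prime_subfield n & t = n * beta.
Proof.
have a0 := alpha_neq0.
move=> /plane_poly_root [m [n [mp np tE]]] /plane_poly_root [m' [n' [mp' np' tE']]].
have sP := prime_subfield_set; have [P1 PB _] := sP.
have sF : subfield_set (Fp_adjoin alpha) by exact: generated_subfield_set.
have [F1 FB FV] := sF; have Fa := Fp_adjoin_alpha.
have FP := prime_Fp_adjoin.
exists n => //.
have e : (n - n') * beta + (m * (1 - alpha) - m' * (1 - alpha^-1)) = 0.
  have -> : (n - n') * beta + (m * (1 - alpha) - m' * (1 - alpha^-1))
    = (m * (1 - alpha) + n * beta) - (m' * (1 - alpha^-1) + n' * beta) by ring.
  by rewrite -tE -tE' subrr.
have Fa' : Fp_adjoin alpha alpha^-1 by rewrite -div1r; apply: FV.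
have [nn mm] : n - n' = 0 /\ m * (1 - alpha) - m' * (1 - alpha^-1) = 0.
  apply: (beta_free _ _ e); first by apply: FB; exact: FP.
  apply: (FB); apply: (subfield_setM sF); try exact: FP.
    exact: FB.
  exact: FB.
have a1 : 1 - alpha != 0.
  by apply/eqP => e1; case: halpha; exists 1%N => //;
     apply/eqP; rewrite -subr_eq0 e1.
have [m0 _] : m = 0 /\ m' = 0.
  apply: alpha_free => //; apply: (mulfI a1); rewrite mulr0.
  have <- : alpha * (m * (1 - alpha) - m' * (1 - alpha^-1))
    = (1 - alpha) * (m * alpha + m') by field.
  by rewrite mm mulr0.
by rewrite tE m0 mul0r add0r.
Qed.

(** Eliminating b leaves (n1 alpha - n2) beta = alpha - 1, which forces alpha = 1. *)
Lemma shifts_not_in_beta_line b n1 n2 : prime_subfield n1 -> prime_subfield n2 ->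
  b + 1 = n1 * beta -> b * alpha + 1 = n2 * beta -> False.
Proof.
move=> p1 p2 e1 e2.
have sF : subfield_set (Fp_adjoin alpha) by exact: generated_subfield_set.
have [F1 FB FV] := sF; have Fa := Fp_adjoin_alpha.
have FP := prime_Fp_adjoin.
have e : (n1 * alpha - n2) * beta + (1 - alpha) = 0.
  rewrite mulrBl -e2 mulrAC -e1; ring.
have [_ /eqP] : n1 * alpha - n2 = 0 /\ 1 - alpha = 0.
  apply: (beta_free _ _ e); last exact: FB.
  by apply: FB; [apply: (subfield_setM sF) => //|]; exact: FP.
by rewrite subr_eq0 => /eqP e3; case: halpha; exists 1%N.
Qed.

End AdditivePolynomialRoots.

(** * Translations of the variables and their action on linear forms *)

Lemma mpoly_rmorph_ext n (k U : comNzRingType)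
    (f h : {rmorphism {mpoly k[n]} -> U}) :
  (forall c, f c%:MP = h c%:MP) -> (forall i, f 'X_i = h 'X_i) -> f =1 h.
Proof.
move=> fC fX q; rewrite (mpolyE q) !rmorph_sum; apply: eq_bigr => m _.
rewrite -mul_mpolyC !rmorphM fC /= mpolyXE_id !rmorph_prod; congr (_ * _).
by apply: eq_bigr => i _; rewrite !rmorphXn /= fX.
Qed.

Section Translations.
Variable k : fieldType.
Local Notation S := {mpoly k[4]}.
Local Notation x1 := (x1 k).
Local Notation x2 := (x2 k).
Local Notation x3 := (x3 k).
Local Notation y := (y k).

(** A family containing all four generators, in which composition is addition of parameters. *)
Definition translation (u v w : k) : S -> S :=
  subst4 x1 (x2 + u *: x1) x3 (y + v *: x1 + w *: x3).

HB.instance Definition _ u v w := GRing.RMorphism.copy (translation u v w)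
  (@comp_mpoly 4 k 4 [tuple x1; x2 + u *: x1; x3; y + v *: x1 + w *: x3]).

Lemma translationC u v w c : translation u v w c%:MP = c%:MP.
Proof. exact: comp_mpolyC. Qed.

Lemma translationZ u v w c f :
  translation u v w (c *: f) = c *: translation u v w f.
Proof. exact: comp_mpolyZ. Qed.

Lemma translationD u v w : {morph translation u v w : f g / f + g}.
Proof. exact: rmorphD. Qed.

Lemma translation_x1 u v w : translation u v w x1 = x1.
Proof. by rewrite /translation /subst4 comp_mpolyXU. Qed.

Lemma translation_x2 u v w : translation u v w x2 = x2 + u *: x1.
Proof. by rewrite /translation /subst4 comp_mpolyXU. Qed.

Lemma translation_x3 u v w : translation u v w x3 = x3.
Proof. by rewrite /translation /subst4 comp_mpolyXU. Qed.

Lemma translation_y u v w : translation u v w y = y + v *: x1 + w *: x3.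
Proof. by rewrite /translation /subst4 comp_mpolyXU. Qed.

Definition translationE :=
  (translation_x1, translation_x2, translation_x3, translation_y).

Lemma rmorph_ext4 (U : comNzRingType) (f h : {rmorphism S -> U}) :
  (forall c, f c%:MP = h c%:MP) -> f x1 = h x1 -> f x2 = h x2 ->
  f x3 = h x3 -> f y = h y -> f =1 h.
Proof.
by move=> fC f1 f2 f3 f4; apply: mpoly_rmorph_ext => // -[[|[|[|[|i]]]] lti].
Qed.

Lemma translation_comp u v w u' v' w' :
  translation u v w \o translation u' v' w'
    = translation (u + u') (v + v') (w + w').
Proof.
apply/funext; apply: (rmorph_ext4 (f := translation u v w \o translation u' v' w')
  (h := translation (u + u') (v + v') (w + w'))) => [c||||] /=.
- by rewrite !translationC.
- by rewrite !translationE.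
- by rewrite !(translationD, translationZ, translationE) scalerDl addrA.
- by rewrite !translationE.
- by rewrite !(translationD, translationZ, translationE) !scalerDl; ring.
Qed.

Lemma translation0 : translation 0 0 0 = id.
Proof.
apply/funext; apply: (rmorph_ext4 (f := translation 0 0 0) (h := idfun)) => [c||||] /=.
- by rewrite translationC.
- by rewrite translationE.
- by rewrite translationE scale0r addr0.
- by rewrite translationE.
- by rewrite translationE !scale0r !addr0.
Qed.

Lemma translation_iter u v w j :
  iter j (translation u v w) = translation (u *+ j) (v *+ j) (w *+ j).
Proof.
elim: j => [|j IH]; first by rewrite translation0.
rewrite !mulrS -translation_comp -IH; exact/funext.
Qed.

Lemma translationNK u v w :
  cancel (translation u v w) (translation (- u) (- v) (- w)).
Proof.
move=> f; have /funeqP/(_ f) /= := translation_comp (- u) (- v) (- w) u v w.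
by rewrite !addNr translation0.
Qed.

Lemma translation_comm u v w u' v' w' f :
  translation u v w (translation u' v' w' f)
    = translation u' v' w' (translation u v w f).
Proof.
have /funeqP/(_ f) /= -> := translation_comp u v w u' v' w'.
have /funeqP/(_ f) /= -> := translation_comp u' v' w' u v w.
by rewrite addrC [v + _]addrC [w + _]addrC.
Qed.

Definition linear_form (a b c d : k) : S := a *: x1 + b *: x2 + c *: x3 + d *: y.

Lemma homog1_linear_form (s : S) : s \is 1.-homog ->
  exists a b c d, s = linear_form a b c d.
Proof.
move=> /dhomogP hs.
pose e (i : 'I_4) := s@_(U_(i)).
have -> : s = \sum_(i < 4) e i *: 'X_i.
  apply/mpolyP => m; rewrite raddf_sum /=.
  under eq_bigr => i _ do rewrite mcoeffZ mcoeffX.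
  have [/mdeg1P [i /eqP ->]|m1] := boolP (mdeg m == 1%N).
    rewrite (bigD1 i) //= eqxx mulr1 big1 ?addr0 // => j ji.
    by rewrite eq_mnm1 (negPf ji) mulr0.
  rewrite big1 => [|i _].
    by apply: memN_msupp_eq0; apply: contra m1 => /hs ->.
  case: eqP => [me|]; last by rewrite mulr0.
  by rewrite -me mdeg1 in m1.
rewrite !big_ord_recl big_ord0 addr0.
do 4 eexists; rewrite /linear_form !addrA; congr (_ *: _ + _ *: _ + _ *: _ + _ *: _).
(* Expanding the sum produces iterated lifts, which agree with the indices of the named variables
   only in value. *)
all: by congr 'X_[_]; congr mnm1; exact: val_inj.
Qed.

Lemma translation_linear_form u v w a b c d :
  translation u v w (linear_form a b c d)
    = linear_form a b c d + (b * u + d * v) *: x1 + (d * w) *: x3.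
Proof.
rewrite /linear_form !(translationD, translationZ, translationE) !scalerDr !scalerA.
by rewrite scalerDl; ring.
Qed.

End Translations.

(** * Invariants and orbit products for sets of self-maps *)

Lemma invariants_generated (T : Type) (X : set (T -> T)) (f : T) :
  invariants (generated_group X) f <-> forall g, X g -> g f = f.
Proof.
split=> [inv g Xg|fX g]; first by apply: inv; apply: generated_gen.
elim=> [h /fX //|//|h1 h2 _ e1 _ e2|h1 h2 _ e1 c1 c2] /=; first by rewrite e2.
by rewrite -{1}e1 c1.
Qed.

Lemma orbit_prod_invariant (S : comNzRingType) (H : set (S -> S)) (s : S)
    (g : {rmorphism S -> S}) (h : S -> S) :
  (forall g1 g2, H g1 -> H g2 -> H (g1 \o g2)) ->
  H g -> H h -> cancel g h -> cancel h g ->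
  g (orbit_prod H s) = orbit_prod H s.
Proof.
move=> HM Hg Hh gh hg; rewrite /orbit_prod.
have bij : set_bij (orbit_set H s) (orbit_set H s) g.
  split.
  - by move=> _ [g' Hg' <-]; exists (g \o g') => //; exact: HM.
  - by move=> x z _ _; exact: (can_inj gh).
  - move=> _ [g' Hg' <-]; exists (h (g' s)) => //.
    by exists (h \o g') => //; exact: HM.
transitivity (\big[*%R/1]_(t \in orbit_set H s) g t); last first.
  by symmetry; exact: (reindex_fsbig bij).
rewrite rmorph_prod.
(* Both products run over the elements whose factor differs from 1; these supports agree because g t
   = 1 exactly when t = 1. *)
suff -> : finite_support 1 (orbit_set H s) (fun t => t)
  = finite_support 1 (orbit_set H s) g by [].
rewrite /finite_support !unlock; congr (finmap.enum_fset (fset_set (_ `&` _))).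
apply/seteqP; split=> x /= xN1 gx1; apply: xN1; last by rewrite gx1 rmorph1.
by apply: (can_inj gh); rewrite gx1 rmorph1.
Qed.

(** * The groups G and G', the two Artin-Schreier generators, and the specialization *)

Section Counterexample.
Variables (k : fieldType) (p : nat) (chp : p \in [pchar k]) (alpha beta : k).
Local Notation S := {mpoly k[4]}.
Local Notation x1 := (x1 k).
Local Notation x2 := (x2 k).
Local Notation x3 := (x3 k).
Local Notation y := (y k).
Local Notation A := (ringA alpha beta).
Local Notation R := (ringR alpha beta).
Local Notation G' := (G' alpha beta).

Lemma pchar_mpoly : p \in [pchar S].
Proof.
move: chp; rewrite !inE => /andP [-> /eqP e].
by rewrite -(rmorph_nat (@mpolyC 4 k)) e rmorph0 eqxx.
Qed.

Lemma tau1E : @tau1 k = translation 1 1 0.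
Proof. by rewrite /tau1 /translation !scale1r scale0r addr0. Qed.

Lemma tau2E : tau2 alpha = translation alpha 1 0.
Proof. by rewrite /tau2 /translation !scale1r scale0r addr0. Qed.

Lemma tau3E : tau3 beta = translation 0 beta 0.
Proof. by rewrite /tau3 /translation !scale0r !addr0. Qed.

Lemma sigmaE : @sigma k = translation 0 0 1.
Proof. by rewrite /sigma /translation !scale0r scale1r !addr0. Qed.

Lemma G'_translation g : G' g -> exists u v, g = translation u v 0.
Proof.
elim=> [_ [->|->|->]||_ _ _ [u [v ->]] _ [u' [v' ->]]|_ h _ [u [v ->]] gh hg].
- by exists 1, 1; exact: tau1E.
- by exists alpha, 1; exact: tau2E.
- by exists 0, beta; exact: tau3E.
- by exists 0, 0; rewrite translation0.
- by exists (u + u'), (v + v'); rewrite translation_comp addr0.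
- exists (- u), (- v); apply/funext => f; rewrite -{1}oppr0 -{2}[f]hg.
  by rewrite translationNK.
Qed.

Lemma ringA_generators f : A f <->
  [/\ tau1 f = f, tau2 alpha f = f & tau3 beta f = f].
Proof.
rewrite /ringA /G' invariants_generated; split=> [inv|[f1 f2 f3] g [->|->|->]] //.
by split; apply: inv; [exact: Or31|exact: Or32|exact: Or33].
Qed.

Lemma ringR_fixed : R = [set f | A f /\ translation 0 0 1 f = f].
Proof.
rewrite -sigmaE; apply/seteqP; split=> f /=.
  rewrite ringA_generators /ringR /G /= invariants_generated => inv.
  by split; [split|]; apply: inv; [exact: Or41|exact: Or42|exact: Or43|exact: Or44].
rewrite ringA_generators /ringR /G /= invariants_generated.
by move=> [[f1 f2 f3] f4] g [->|->|->|->].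
Qed.

Lemma ringA_subring : subring_set A.
Proof.
split=> [g|a b Aa Ab g|a b Aa Ab g] Hg; have [u [v gE]] := G'_translation Hg.
- by rewrite gE rmorph1.
- by have := (Aa g Hg, Ab g Hg); rewrite gE rmorphB /= => -[-> ->].
- by have := (Aa g Hg, Ab g Hg); rewrite gE rmorphM /= => -[-> ->].
Qed.

Lemma ringA_translation u v w f : A f -> A (translation u v w f).
Proof.
move=> Af g Hg; have [u' [v' gE]] := G'_translation Hg.
by rewrite gE translation_comm -gE Af.
Qed.

Lemma ringA_orbit_prod s : A (orbit_prod G' s).
Proof.
move=> g Hg; have [u [v gE]] := G'_translation Hg.
have gK : cancel (translation u v 0) (translation (- u) (- v) 0).
  by move=> f; rewrite -{1}oppr0 translationNK.
have Kg : cancel (translation (- u) (- v) 0) (translation u v 0).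
  by move=> f; rewrite translation_comm gK.
rewrite gE in Hg *; apply: (orbit_prod_invariant _ _ Hg _ gK Kg).
- exact: generated_comp.
- exact: generated_inv Hg gK Kg.
Qed.

Lemma translation_inj u v w : injective (translation u v w : S -> S).
Proof. exact: can_inj (@translationNK _ u v w). Qed.

Lemma sigma_iter_p f : iter p (translation 0 0 1) f = f :> S.
Proof. by rewrite translation_iter !mul0rn (pcharf0 chp) translation0. Qed.

(* The orbit product of [y - e x2] under G', when (e, u) is (1, 1 - alpha) or
   (1/alpha, 1 - 1/alpha). *)
Definition plane_theta e u := plane_poly p (u *: x1) (beta *: x1) (y - e *: x2).
Definition plane_B u := plane_poly p (u *: x1) (beta *: x1) x3.

Lemma plane_poly_translation u v w e1 e2 f :
  translation u v w (plane_poly p (e1 *: x1) (e2 *: x1) f)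
    = plane_poly p (e1 *: x1) (e2 *: x1) (translation u v w f).
Proof. by rewrite rmorph_plane_poly /= !translationZ !translationE. Qed.

Lemma plane_theta_translation e u u' v' w' :
  translation u' v' w' (plane_theta e u)
   = plane_theta e u + plane_poly p (u *: x1) (beta *: x1) ((v' - e * u') *: x1)
     + plane_poly p (u *: x1) (beta *: x1) (w' *: x3).
Proof.
rewrite plane_poly_translation -!(plane_polyD pchar_mpoly).
congr plane_poly; rewrite rmorphB /= !(translationD, translationZ, translationE).
by rewrite scalerDr scalerBl scalerA; ring.
Qed.

Lemma plane_B_translation u u' v' w' :
  translation u' v' w' (plane_B u) = plane_B u.
Proof. by rewrite plane_poly_translation translationE. Qed.

Lemma plane_B_ringA u : A (plane_B u).
Proof.
by move=> g /G'_translation [u' [v' ->]]; exact: plane_B_translation.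
Qed.

Lemma plane_B_neq0 u : plane_B u != 0.
Proof.
(* At x3 = 1 with the other variables 0, both spanning vectors vanish and the polynomial t^(p^2)
   remains, with value 1. *)
apply/eqP => /(congr1 (meval (fun i : 'I_4 => (i == 2 :> nat)%:R : k))).
rewrite rmorph0 rmorph_plane_poly /= !mevalZ !mevalXU /= !mulr0.
have p1 : (p.-1 == 0)%N = false.
  by rewrite gtn_eqF // -subn1 subn_gt0; exact/prime_gt1/pcharf_prime/chp.
rewrite /plane_poly (line_poly0 chp) /line_poly expr0n p1 !mul0r !subr0 !expr1n.
by move/eqP; rewrite oner_eq0.
Qed.

(** The generators of G' shift y - e x2 by (1 - e) x1, (1 - e alpha) x1 and beta x1, all of them
    roots of the additive polynomial. *)
Lemma plane_theta_ringA e u :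
  1 - e = 0 \/ 1 - e = u -> 1 - e * alpha = 0 \/ 1 - e * alpha = u ->
  A (plane_theta e u).
Proof.
have kill t : t = 0 \/ t = u -> plane_poly p (u *: x1) (beta *: x1) (t *: x1) = 0.
  case=> ->; last exact: plane_poly_l pchar_mpoly _ _.
  by rewrite scale0r; exact: plane_poly0 pchar_mpoly _ _.
have p0 := plane_poly0 pchar_mpoly.
move=> e1 e2; rewrite ringA_generators tau1E tau2E tau3E.
rewrite !plane_theta_translation !scale0r !p0 mulr1 mulr0 subr0 !addr0.
split; [by rewrite kill ?addr0|by rewrite kill ?addr0|].
by rewrite (plane_poly_r pchar_mpoly) addr0.
Qed.

Lemma sigma_plane_theta e u :
  translation 0 0 1 (plane_theta e u) = plane_theta e u + plane_B u.
Proof.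
rewrite plane_theta_translation mulr0 subr0 scale0r scale1r.
by rewrite (plane_poly0 pchar_mpoly) addr0.
Qed.

Lemma plane_B_different e u :
  1 - e = 0 \/ 1 - e = u -> 1 - e * alpha = 0 \/ 1 - e * alpha = u ->
  dedekind_different R A (tofrac (plane_B u ^+ p.-1)).
Proof.
move=> e1 e2.
apply: (different_artin_schreier pchar_mpoly (@translation_inj 0 0 1)
  ringA_subring ringR_fixed _ _ (plane_theta_ringA e1 e2)).
- by move=> a; exact: ringA_translation.
- by move=> a _; exact: sigma_iter_p.
- exact: plane_B_ringA.
- exact: plane_B_translation.
- exact: sigma_plane_theta.
- exact: plane_B_neq0.
Qed.

Lemma TrFK_tofrac a : A a ->
  TrFK alpha beta (tofrac a)
    = tofrac (\sum_(j < p) iter j (translation 0 0 1) a).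
Proof.
(* The trace formula asks for some Artin-Schreier generator; the one with e = 1 is taken. *)
have e1 : 1 - 1 = 0 :> k \/ 1 - 1 = 1 - alpha by left; rewrite subrr.
have e2 : 1 - 1 * alpha = 0 :> k \/ 1 - 1 * alpha = 1 - alpha.
  by right; rewrite mul1r.
apply: (field_trace_tofrac pchar_mpoly (@translation_inj 0 0 1)
  ringA_subring ringR_fixed _ _ (plane_theta_ringA e1 e2)).
- by move=> b; exact: ringA_translation.
- by move=> b _; exact: sigma_iter_p.
- exact: (plane_B_ringA (1 - alpha)).
- exact: (plane_B_translation (1 - alpha)).
- exact: (sigma_plane_theta 1 (1 - alpha)).
- exact: (plane_B_neq0 (1 - alpha)).
Qed.

(* The orbit elements are the s + e x1, on which sigma adds d x3 and an element
   of G' moving s by w x1 adds w x1; these agree after x3 := w/d, x1 := 1. *)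
Lemma orbit_prod_specialization (U : comNzRingType) (ev : {rmorphism S -> U})
    a b c d u v : G' (translation u v 0) ->
  ev (d *: x3) = ev ((b * u + d * v) *: x1) ->
  forall j, ev (iter j (translation 0 0 1) (orbit_prod G' (linear_form a b c d)))
    = ev (orbit_prod G' (linear_form a b c d)).
Proof.
move=> Hg ev13 j; set N := orbit_prod _ _.
have gN : iter j (translation u v 0) N = N.
  by elim: j => //= j ->; exact: ringA_orbit_prod Hg.
(* Writing the right-hand N as its own translate lets both products run over the same orbit, to be
   compared factor by factor. *)
rewrite -[in RHS]gN /N /orbit_prod !translation_iter !rmorph_prod.
rewrite big_seq [RHS]big_seq; apply: eq_bigr => t.
case: finite_supportP => // X XP _ _ tX.
have [g Hg' <-] : orbit_set G' (linear_form a b c d) t by exact: XP.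
have [u' [v' ->]] := G'_translation Hg'.
rewrite /= 2!(translation_comm _ _ _ u') !translation_linear_form !mul0rn !mulr0.
rewrite !addr0 !scale0r !addr0 !translationD !translationZ !translationE.
rewrite !rmorphD /=; congr (_ + _).
by rewrite !mulrnAr -mulrnDl mulr1 -!scalerMnl !rmorphMn /= ev13.
Qed.

End Counterexample.

Theorem proposition5p12 (k : fieldType) (p : nat) (hp : p \in [pchar k])
    (alpha beta : k) (halpha : ~ prime_subfield alpha)
    (hbeta : ~ Fp_adjoin alpha beta)
    (Delta : {mpoly k[4]})
    (hDelta : homogeneous_different_generator alpha beta Delta) :
  ~ exists s : {mpoly k[4]},
      s \is 1.-homog /\
      exists c : k, c != 0 /\
        TrFK alpha beta (tofrac (orbit_prod (G' alpha beta) s ^+ p.-1))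
          / tofrac Delta = tofrac c%:MP.
Proof.
move=> [s [/homog1_linear_form [a [b [c [d ->]]]] [r [r0]]]].
have pS := pchar_mpoly hp.
set N := orbit_prod _ _; pose g := translation 0 0 (1 : k).
rewrite (TrFK_tofrac hp); last first.
  by apply: (subring_setX (ringA_subring _ _)); exact: ringA_orbit_prod.
have [_ [_ DE]] := hDelta.
move=> traceE.
(* Division by 0 gives 0, which is not the nonzero constant r. *)
have Delta0 : Delta != 0.
  apply/eqP => e; move: traceE; rewrite e tofrac0 invr0 mulr0 => /esym/eqP.
  by rewrite tofrac_eq0 mpolyC_eq0 (negPf r0).
have trE : \sum_(j < p) iter j g (N ^+ p.-1) = r%:MP * Delta.
  apply/eqP; rewrite -tofrac_eq tofracM -traceE divfK ?tofrac_eq0 //.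
(* A specialization identifying all conjugates of N turns the trace into p equal terms, that is,
   0. *)
have trX (U : comNzRingType) (ev : {rmorphism {mpoly k[4]} -> U}) :
    (forall j, ev (iter j g N) = ev N) -> ev (r%:MP * Delta) = 0.
  move=> evN; rewrite -trE rmorph_sum /=.
  have evX j : ev (iter j g (N ^+ p.-1)) = ev (N ^+ p.-1).
    by rewrite translation_iter !rmorphXn /= -(evN j) translation_iter.
  under eq_bigr => j _ do rewrite evX.
  by rewrite sumr_const card_ord -rmorphMn -mulr_natl (pcharf0 pS) mul0r
    rmorph0.
have gen1 : G' alpha beta (translation 1 1 0).
  by rewrite -tau1E; apply: generated_gen; exact: Or31.
have gen2 : G' alpha beta (translation alpha 1 0).
  by rewrite -tau2E; apply: generated_gen; exact: Or32.
have gen0 : G' alpha beta (translation 0 0 0).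
  by rewrite translation0; exact: generated_id.
have [d0|d0] := eqVneq d 0.
  have /eqP : r%:MP * Delta = 0.
    apply: (trX _ idfun); apply: (orbit_prod_specialization (ev := idfun) _ _ gen0).
    by rewrite d0 !mulr0 addr0 !scale0r.
  by rewrite mulf_eq0 (negPf Delta0) mpolyC_eq0 (negPf r0).
have root u v : G' alpha beta (translation u v 0) ->
    exists2 n, prime_subfield n & (b * u + d * v) / d = n * beta.
  move=> Hg; set w := _ / d.
  (* The point x1 = 1, x3 = w satisfies the relation d x3 = (b u + d v) x1; x2 and y are set to
     0. *)
  pose ev : {rmorphism {mpoly k[4]} -> k} :=
    meval (fun i : 'I_4 => nth 0 [:: 1; 0; w; 0] i).
  have evD : ev Delta = 0.
    have /eqP : ev (r%:MP * Delta) = 0.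
      apply: trX; apply: (orbit_prod_specialization _ _ Hg).
      by rewrite /= !mevalZ !mevalXU /= mulr1 mulrC divfK.
    by rewrite rmorphM mulf_eq0 /= mevalC (negPf r0) => /eqP.
  (* Delta divides the (p-1)-th power of [plane_B u'], so this form vanishes at the point as
     well. *)
  have evB e u' : 1 - e = 0 \/ 1 - e = u' ->
      1 - e * alpha = 0 \/ 1 - e * alpha = u' ->
      plane_poly p u' beta w = 0.
    move=> e1 e2; have := plane_B_different hp beta e1 e2.
    rewrite DE => -[q _ /eqP]; rewrite tofrac_eq => /eqP/(congr1 ev)/eqP.
    rewrite rmorphM evD mul0r rmorphXn eq_sym expf_eq0 => /andP [_ /eqP].
    by rewrite rmorph_plane_poly /= !mevalZ !mevalXU /= !mulr1.
  apply: (plane_polys_common_root hp halpha hbeta).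
    by apply: (evB 1); [left; rewrite subrr|right; rewrite mul1r].
  apply: (evB alpha^-1); [by right|left].
  by rewrite mulVf ?subrr // alpha_neq0.
(* The translations [tau1] and [tau2] give w = b/d + 1 and w = (b/d) alpha + 1. *)
have [n1 n1p e1] := root _ _ gen1; have [n2 n2p e2] := root _ _ gen2.
apply: (shifts_not_in_beta_line halpha hbeta (b := b / d) n1p n2p).
  by rewrite -e1 !mulr1 mulrDl divff.
by rewrite -e2 mulr1 mulrDl divff // mulrAC.
Qed.
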